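(* Let $M$ and $N$ be finitely presented $B_n$-persistence modules. If $d_I(M,N)=\epsilon$ (with $\epsilon\in[0,\infty)$), then $M$ and $N$ are $\epsilon$-interleaved.
   Context: Fix a field $k$ and $n\ge 1$. $B_n=k[\mathbb{R}_{\ge0}^n]$ is the monoid ring of $(\mathbb{R}^n_{\ge0},+)$ (spanned by monomials $x_1^{r_1}\cdots x_n^{r_n}$, $r_i\in\mathbb{R}_{\ge 0}$). $\mathbb{R}^n$ carries the product partial order. A $B_n$-persistence module is a $B_n$-module $M$ with a $k$-vector space decomposition $M=\bigoplus_{a\in\mathbb{R}^n}M_a$ such that $x_i^{\alpha}(M_a)\subset M_{a+\alpha \mathbf{e}_i}$ for all $a$, $\alpha\ge0$; morphisms are module homomorphisms $f$ with $f(M_a)\subset N_a$ for all $a$. For $a\le b$ the transition map $\varphi_M(a,b):M_a\to M_b$ is multiplication by $x_1^{b_1-a_1}\cdots x_n^{b_n-a_n}$. For $v\in\mathbb{R}^n$, $M(v)_a=M_{a+v}$. An $n$-graded set is a set $G$ with a grade function $gr:G\to\mathbb{R}^n$; the free module on it is $\langle G\rangle=\bigoplus_{y\in G}B_n(-gr(y))$. $M$ is finitely presented if $M\cong\langle G\rangle/\langle R\rangle$ for a finite $n$-graded set $G$ and a finite set $R\subset\langle G\rangle$ of homogeneous elements. For $\epsilon\ge0$ let $\vec\epsilon=(\epsilon,\dots,\epsilon)$, $M(\epsilon)=M(\vec\epsilon)$, $f(\epsilon)_a=f_{a+\vec\epsilon}$ for morphisms $f$, and $S(M,\epsilon):M\to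 M(\epsilon)$ with $S(M,\epsilon)_a=\varphi_M(a,a+\vec\epsilon)$. $M,N$ are $\epsilon$-interleaved if there are morphisms $f:M\to N(\epsilon)$, $g:N\to M(\epsilon)$ with $g(\epsilon)\circ f=S(M,2\epsilon)$ and $f(\epsilon)\circ g=S(N,2\epsilon)$. $d_I(M,N)=\inf\{\epsilon\ge0: M,N\text{ are }\epsilon\text{-interleaved}\}$. *)

(* Defs.v *)
From HB Require Import structures.
From mathcomp Require Import all_boot all_order all_algebra.
From mathcomp Require Import generic_quotient ring_quotient.
From mathcomp Require Import finmap monalg.
From mathcomp Require Import boolp classical_sets interval_inference reals ereal.

Set Implicit Arguments.
Unset Strict Implicit.
Unset Printing Implicit Defensive.

Import Order.TTheory GRing.Theory Num.Theory.
Local Open Scope ring_scope.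

Section Exponents.
Variables (R : realType) (n : nat).

Definition vec_le (a b : 'rV[R]_n) : bool := [forall i, a 0 i <= b 0 i].

Record expo := Expo { expo_val :> 'rV[R]_n; expo_ge0 : vec_le 0 expo_val }.

HB.instance Definition _ := [isSub for expo_val].
HB.instance Definition _ := [Choice of expo by <:].

Lemma expoP (e : expo) i : 0 <= expo_val e 0 i.
Proof. by case: e => v /= /forallP /(_ i); rewrite mxE. Qed.

Fact expo_zero_subproof : vec_le 0 (0 : 'rV[R]_n).
Proof. by apply/forallP => i. Qed.

Fact expo_add_subproof (e f : expo) : vec_le 0 (expo_val e + expo_val f).
Proof. by apply/forallP => i; rewrite !mxE addr_ge0 ?expoP. Qed.

Definition expo_zero := Expo expo_zero_subproof.
Definition expo_add e f := Expo (expo_add_subproof e f).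

Fact expo_addA : associative expo_add.
Proof. by move=> x y z; apply/val_inj; rewrite /= addrA. Qed.
Fact expo_addC : commutative expo_add.
Proof. by move=> x y; apply/val_inj; rewrite /= addrC. Qed.
Fact expo_add0 : left_id expo_zero expo_add.
Proof. by move=> x; apply/val_inj; rewrite /= add0r. Qed.
Fact expo_addr0 : right_id expo_zero expo_add.
Proof. by move=> x; apply/val_inj; rewrite /= addr0. Qed.
Fact expo_unit x y : expo_add x y = expo_zero -> x = expo_zero /\ y = expo_zero.
Proof.
move=> /(congr1 val) /= /rowP xy0.
have xy i : expo_val x 0 i = 0 /\ expo_val y 0 i = 0.
  have := xy0 i; rewrite !mxE => /eqP.
  by rewrite paddr_eq0 ?expoP // => /andP[/eqP-> /eqP->].
by split; apply/val_inj/rowP => i /=; rewrite mxE; case: (xy i).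
Qed.

HB.instance Definition _ := Choice_isMonomialDef.Build expo
  expo_addA expo_add0 expo_addr0 expo_unit.
HB.instance Definition _ := MonomialDef_isConomialDef.Build expo expo_addC.

Fact expo_axis_subproof (i : 'I_n) (alpha : {nonneg R}) :
  vec_le 0 (alpha%:num *: delta_mx 0 i : 'rV[R]_n).
Proof. by apply/forallP => j; rewrite !mxE mulr_ge0 // ler0n. Qed.

Definition expo_axis i alpha := Expo (expo_axis_subproof i alpha).

Fact expo_const_subproof (eps : {nonneg R}) :
  vec_le 0 (const_mx eps%:num : 'rV[R]_n).
Proof. by apply/forallP => j; rewrite !mxE. Qed.

Definition expo_const eps := Expo (expo_const_subproof eps).

Fact expo_sub_subproof (a b : 'rV[R]_n) : vec_le a b -> vec_le 0 (b - a).
Proof. by move=> /forallP ab; apply/forallP => i; rewrite !mxE subr_ge0. Qed.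

Definition expo_sub a b (ab : vec_le a b) := Expo (expo_sub_subproof ab).

End Exponents.

(* The monoid ring k[R_{>=0}^n]; [<< e >>] is the monomial x^e and [c%:MP] the
   image of the scalar c. *)
Definition Bn (k : fieldType) (R : realType) (n : nat) := {malg k[expo R n]}.
HB.instance Definition _ k R n := GRing.ComNzRing.on (Bn k R n).

Definition xmon {k : fieldType} {R : realType} {n : nat} (e : expo R n)
  : Bn k R n := << e >>.

(* The components [pm_comp a] are k-subspaces whose internal direct sum is the whole
   module: every element is a finite sum of elements of distinct components
   ([comp_span]), and such a sum vanishes only trivially ([comp_indep]). *)
Record persMod (k : fieldType) (R : realType) (n : nat) := PersMod {
  pm_mod :> lmodType (Bn k R n);
  pm_comp : 'rV[R]_n -> set pm_mod;
  comp0 : forall a, pm_comp a 0;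
  compD : forall a x y, pm_comp a x -> pm_comp a y -> pm_comp a (x + y);
  compZ : forall a (c : k) x, pm_comp a x -> pm_comp a ((c%:MP : Bn k R n) *: x);
  comp_span : forall x, exists (s : seq 'rV[R]_n) (u : 'rV[R]_n -> pm_mod),
    [/\ uniq s, forall a, pm_comp a (u a) & x = \sum_(a <- s) u a];
  comp_indep : forall (s : seq 'rV[R]_n) (u : 'rV[R]_n -> pm_mod),
    uniq s -> (forall a, pm_comp a (u a)) -> \sum_(a <- s) u a = 0 ->
    forall a, a \in s -> u a = 0;
  comp_act : forall (i : 'I_n) (alpha : {nonneg R}) a x,
    pm_comp a x ->
    pm_comp (a + alpha%:num *: delta_mx 0 i) (xmon (expo_axis i alpha) *: x)
}.

Arguments pm_comp {k R n M} a _ : rename.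

Section PersistenceModules.
Variables (k : fieldType) (R : realType) (n : nat).
Local Notation B := (Bn k R n).
Local Notation pmod := (persMod k R n).
Local Notation vec := 'rV[R]_n.
Local Notation xmon := (@xmon k R n).
Implicit Types (M N P : pmod) (a b v : vec) (e : expo R n) (eps : {nonneg R}).

Lemma xmonD e f : xmon (expo_add e f) = xmon e * xmon f.
Proof. by rewrite [RHS]fgmulUU mulr1. Qed.

Lemma compN M a x : pm_comp a x -> pm_comp a (- x : M).
Proof.
move=> /(compZ (-1)); rewrite monalgUN scaleNr.
by rewrite -[X in _ -> pm_comp a (- X)](scale1r x).
Qed.

Lemma comp_sum M a (I : Type) (r : seq I) (p : pred I) (F : I -> M) :
  (forall i, p i -> pm_comp a (F i)) -> pm_comp a (\sum_(i <- r | p i) F i).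
Proof. by move=> Fa; apply: big_ind => //; [exact: comp0|exact: compD]. Qed.

Lemma comp_mon M a e x : pm_comp a x -> pm_comp (a + e) (xmon e *: x : M).
Proof.
move=> ax.
pose ax_ i := expo_axis i (NngNum (expoP e i)).
pose ep (s : seq 'I_n) := \big[@expo_add R n/expo_zero R n]_(i <- s) ax_ i.
have comp_ep s : pm_comp (a + ep s) (xmon (ep s) *: x).
  rewrite /ep; elim: s => [|i s IHs]; first by rewrite big_nil addr0 scale1r.
  rewrite big_cons xmonD -scalerA /= [_ + expo_val _]addrC addrA.
  exact: (@comp_act _ _ _ M i (NngNum (expoP e i)) _ _ IHs).
suff -> : e = ep (index_enum 'I_n) by exact: comp_ep.
apply/val_inj; rewrite /ep (big_morph val (id1 := 0) (op1 := +%R)) //=.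
exact: row_sum_delta.
Qed.

Record hom M N := Hom {
  hom_fun :> {linear M -> N};
  hom_comp : forall a x, pm_comp a x -> pm_comp a (hom_fun x)
}.

Definition comp_lin M N P (g : {linear N -> P}) (f : {linear M -> N})
  : {linear M -> P} := g \o f.

Definition hom_compose M N P (g : hom N P) (f : hom M N) : hom M P :=
  @Hom M P (comp_lin g f) (fun a x h => hom_comp g (hom_comp f h)).

Definition isomorphic M N : Prop :=
  exists (f : hom M N) (g : hom N M), cancel f g /\ cancel g f.

Section Shift.
Variables (v : vec) (M : pmod).

Let scomp a : set M := pm_comp (a + v).

Fact shift_span (x : M) : exists (s : seq vec) (u : vec -> M),
  [/\ uniq s, forall a, scomp a (u a) & x = \sum_(a <- s) u a].
Proof.
have [s [u [us uc ->]]] := comp_span x.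
exists [seq a - v | a <- s], (fun a => u (a + v)); split=> //.
- by rewrite map_inj_uniq //; exact: addIr.
- by move=> a; exact: uc.
- by rewrite big_map; apply: eq_bigr => a _; rewrite subrK.
Qed.

Fact shift_indep (s : seq vec) (u : vec -> M) : uniq s ->
  (forall a, scomp a (u a)) -> \sum_(a <- s) u a = 0 ->
  forall a, a \in s -> u a = 0.
Proof.
move=> us uc su a sa.
have := @comp_indep _ _ _ M [seq a + v | a <- s] (fun a => u (a - v)).
rewrite map_inj_uniq; last exact: addIr.
move=> /(_ us) H; have := H _ _ (a + v); rewrite addrK; apply.
- by move=> b; have := uc (b - v); rewrite /scomp subrK.
- by rewrite big_map -[RHS]su; apply: eq_bigr => b _; rewrite addrK.
- exact: (map_f (fun b => b + v)).

Qed.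

Fact shift_act (i : 'I_n) (alpha : {nonneg R}) a x : scomp a x ->
  scomp (a + alpha%:num *: delta_mx 0 i) (xmon (expo_axis i alpha) *: x).
Proof. by move=> /(comp_act i alpha); rewrite /scomp addrAC. Qed.

Definition shift : pmod :=
  @PersMod k R n M scomp (fun a => @comp0 _ _ _ M (a + v))
    (fun a => @compD _ _ _ M (a + v)) (fun a => @compZ _ _ _ M (a + v))
    shift_span shift_indep shift_act.

End Shift.

Definition shiftc eps M : pmod := shift (const_mx eps%:num) M.

(* f(eps) is f itself as a map of the underlying modules. *)
Definition hom_shiftc eps M N (f : hom M N) : hom (shiftc eps M) (shiftc eps N) :=
  @Hom (shiftc eps M) (shiftc eps N) (hom_fun f) (fun a x h => hom_comp f h).

Definition transition M a b (ab : vec_le a b) (x : M) : M :=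
  xmon (expo_sub ab) *: x.

Lemma transition_comp M a b (ab : vec_le a b) (x : M) :
  pm_comp a x -> pm_comp b (transition ab x).
Proof.
by move=> /(@comp_mon M a (expo_sub ab)); rewrite /= addrC subrK.
Qed.

Definition mul_mon M e (x : M) : M := xmon e *: x.

Fact mul_mon_linear M e : linear (@mul_mon M e).
Proof.
by move=> c x y; rewrite /mul_mon scalerDr !scalerA [_ * c]mulrC.
Qed.
HB.instance Definition _ M e :=
  GRing.isLinear.Build B M M *:%R (@mul_mon M e) (@mul_mon_linear M e).

Fact shift_map_comp M eps a (x : M) :
  pm_comp a x -> pm_comp (M := shiftc eps M) a (mul_mon (expo_const n eps) x).
Proof. exact: (@comp_mon M a (expo_const n eps)). Qed.

(* S(M, eps) is given on all of M at once: on every component it is the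
   multiplication by the same monomial, see [shift_mapE]. *)
Definition shift_map M eps : hom M (shiftc eps M) :=
  @Hom M (shiftc eps M) (@mul_mon M (expo_const n eps)) (@shift_map_comp M eps).

Lemma shift_mapE M eps a (h : vec_le a (a + const_mx eps%:num)) (x : M) :
  shift_map M eps x = transition h x.
Proof.
have hE : expo_sub h = expo_const n eps.
  by apply/val_inj; rewrite /= addrC addKr.
by rewrite /transition hE.
Qed.

(* M(eps)(eps) and M(2 eps) have the same underlying module, where the two
   composites are compared with S(M, 2 eps) and S(N, 2 eps). *)
Definition interleaved M N eps : Prop :=
  exists (f : hom M (shiftc eps N)) (g : hom N (shiftc eps M)),
    (forall x : M, hom_compose (hom_shiftc eps g) f x
                   = shift_map M (2 * eps%:num)%:nng x) /\
    (forall y : N, hom_compose (hom_shiftc eps f) g y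
                   = shift_map N (2 * eps%:num)%:nng y).

Definition interleaving_distance M N : \bar R :=
  ereal_inf [set (eps%:num)%:E | eps in [set eps | interleaved M N eps]].

Section Regular.

(* The component of degree a is k x^a if a >= 0, and 0 otherwise. *)
Definition regular_comp a : set B^o :=
  fun p => forall e, e \in msupp (p : B) -> val e = a.

Fact regular_comp0 a : regular_comp a 0.
Proof. by move=> e; rewrite msupp0. Qed.

Fact regular_compD a (p q : B^o) :
  regular_comp a p -> regular_comp a q -> regular_comp a (p + q).
Proof.
move=> pa qa e /(fsubsetP (msuppD_le _ _)); rewrite in_fsetU.
by case/orP => [/pa|/qa].
Qed.

Fact regular_compM a e (c : k) (p : B^o) : regular_comp a p ->
  regular_comp (a + e) ((<< c *g e >> : B) *: p).
Proof.
move=> pa f /msuppM_le[e1 [e2 [/(fsubsetP msuppU_le)]]].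
by rewrite inE => /eqP -> /pa <- ->; rewrite /= addrC.
Qed.

Fact regular_compZ a (c : k) (p : B^o) :
  regular_comp a p -> regular_comp a ((c%:MP : B) *: p).
Proof.
by move=> /(@regular_compM a (expo_zero R n) c); rewrite [a + _]addr0.
Qed.

Fact regular_comp_act (i : 'I_n) (alpha : {nonneg R}) a (p : B^o) :
  regular_comp a p -> regular_comp (a + alpha%:num *: delta_mx 0 i)
                                   (xmon (expo_axis i alpha) *: p).
Proof. exact: (@regular_compM a (expo_axis i alpha) 1). Qed.

Definition regular_part (p : B^o) a : B^o :=
  if insub a is Some e then << (p : B)@_e *g e >> else 0.

Lemma regular_partP p a : regular_comp a (regular_part p a).
Proof.
rewrite /regular_part; case: insubP => [e _ <-|_]; last exact: regular_comp0.
by move=> f /(fsubsetP msuppU_le); rewrite inE => /eqP->.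
Qed.

Lemma regular_part_sum (s : seq vec) (p : B^o) : uniq s ->
  {subset [seq val e | e <- msupp (p : B)] <= s} ->
  p = \sum_(a <- s) regular_part p a.
Proof.
move=> us ps; apply/malgP => f.
rewrite (raddf_sum (mcoeff f)) /=.
have part_val e : regular_part p (val e) = << (p : B)@_e *g e >>.
  by rewrite /regular_part valK.
have [fs|fs] := boolP (val f \in s).
  rewrite (bigD1_seq (val f)) //= part_val mcoeffUU big1 ?addr0 // => a af.
  apply: mcoeff_outdom; apply/negP => /regular_partP fa.
  by rewrite -fa eqxx in af.
rewrite mcoeff_outdom; last by apply: contra fs => fp; exact/ps/map_f.
rewrite big1_seq // => a /= sa.
apply: mcoeff_outdom; apply/negP => /regular_partP fa.
by rewrite fa sa in fs.
Qed.

Fact regular_span (p : B^o) : exists (s : seq vec) (u : vec -> B^o),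
  [/\ uniq s, forall a, regular_comp a (u a) & p = \sum_(a <- s) u a].
Proof.
exists [seq val e | e <- msupp (p : B)], (regular_part p).
have us : uniq [seq val e | e <- msupp (p : B)].
  by rewrite map_inj_uniq ?fset_uniq //; exact: val_inj.
by split=> //; [exact: regular_partP|exact: regular_part_sum].
Qed.

Fact regular_indep (s : seq vec) (u : vec -> B^o) : uniq s ->
  (forall a, regular_comp a (u a)) -> \sum_(a <- s) u a = 0 ->
  forall a, a \in s -> u a = 0.
Proof.
move=> us uc su a sa; apply/malgP => e; rewrite mcoeff0.
have [/uc ea|//] := msuppP (u a : B) e.
have := congr1 (mcoeff e) su.
rewrite (raddf_sum (mcoeff e)) /= mcoeff0 (bigD1_seq a) //= big1 ?addr0 //.
move=> b ba; apply: mcoeff_outdom; apply/negP => /uc eb.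
by rewrite -eb ea eqxx in ba.
Qed.

Definition regular_pm : pmod :=
  @PersMod k R n (B^o) regular_comp regular_comp0 regular_compD
    regular_compZ regular_span regular_indep regular_comp_act.

End Regular.

Section Free.
Variables (G : finType) (gr : G -> vec).

(* The carrier is the direct sum over y of copies of the ring, the copy of index
   y being graded as its shift by - gr y. *)
Definition free_comp a : set {ffun G -> B^o} :=
  fun p => forall y, pm_comp (M := shift (- gr y) regular_pm) a (p y).

Fact free_comp0 a : free_comp a 0.
Proof. by move=> y; rewrite ffunE; exact: comp0. Qed.

Fact free_compD a p q : free_comp a p -> free_comp a q -> free_comp a (p + q).
Proof. by move=> pa qa y; rewrite ffunE; apply: compD. Qed.

Fact free_compZ a (c : k) p :
  free_comp a p -> free_comp a ((c%:MP : B) *: p).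
Proof. by move=> pa y; rewrite ffunE; apply: compZ. Qed.

Fact free_comp_act (i : 'I_n) (alpha : {nonneg R}) a p :
  free_comp a p -> free_comp (a + alpha%:num *: delta_mx 0 i)
                             (xmon (expo_axis i alpha) *: p).
Proof. by move=> pa y; rewrite ffunE; apply: comp_act. Qed.

Fact free_span p : exists (s : seq vec) (u : vec -> {ffun G -> B^o}),
  [/\ uniq s, forall a, free_comp a (u a) & p = \sum_(a <- s) u a].
Proof.
pose s := undup
  (flatten [seq [seq val e + gr y | e <- msupp (p y : B)] | y <- enum G]).
exists s, (fun a => [ffun y => regular_part (p y) (a - gr y)]); split.
- exact: undup_uniq.
- by move=> a y; rewrite ffunE; exact: regular_partP.
apply/ffunP => y; rewrite sum_ffunE.
under eq_bigr do rewrite ffunE.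
rewrite -(big_map (fun a => a - gr y) xpredT (regular_part (p y))).
apply: regular_part_sum.
  by rewrite map_inj_uniq ?undup_uniq //; exact: addIr.
move=> _ /mapP[e ep ->]; apply/mapP; exists (val e + gr y); last by rewrite addrK.
rewrite mem_undup; apply/flattenP.
exists [seq val e + gr y | e <- msupp (p y : B)]; last exact: map_f.
by apply/mapP; exists y; rewrite ?mem_enum.
Qed.

Fact free_indep (s : seq vec) (u : vec -> {ffun G -> B^o}) : uniq s ->
  (forall a, free_comp a (u a)) -> \sum_(a <- s) u a = 0 ->
  forall a, a \in s -> u a = 0.
Proof.
move=> us uc su a sa; apply/ffunP => y; rewrite ffunE.
apply: (@comp_indep _ _ _ (shift (- gr y) regular_pm) s (fun a => u a y)) => //.
  by move=> b; exact: uc.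
by have := congr1 (fun p : {ffun G -> B^o} => p y) su; rewrite sum_ffunE [RHS]ffunE.
Qed.

Definition free_pm : pmod :=
  @PersMod k R n {ffun G -> B^o} free_comp free_comp0 free_compD
    free_compZ free_span free_indep free_comp_act.

End Free.

Definition homogeneous M (x : M) : Prop := exists a, pm_comp a x.

Section Quotient.
Variables (M : pmod) (S : {fset M}).

Definition submod_span : {pred M} := fun x =>
  `[< exists c : M -> B, x = \sum_(r <- S) c r *: r >].

Lemma submod_spanP x :
  reflect (exists c : M -> B, x = \sum_(r <- S) c r *: r) (x \in submod_span).
Proof. exact: asboolP. Qed.

Fact submod_span_zmod_closed : zmod_closed submod_span.
Proof.
split=> [|x y /submod_spanP[c ->] /submod_spanP[d ->]]; apply/submod_spanP.
  by exists (fun=> 0); rewrite big1 // => r _; rewrite scale0r.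
exists (fun r => c r - d r); rewrite -sumrB.
by apply: eq_bigr => r _; rewrite scalerBl.
Qed.
HB.instance Definition _ := GRing.isZmodClosed.Build M submod_span
  submod_span_zmod_closed.

Lemma submod_spanZ c x : x \in submod_span -> c *: x \in submod_span.
Proof.
case/submod_spanP => d ->; apply/submod_spanP; exists (fun r => c * d r).
by rewrite scaler_sumr; apply: eq_bigr => r _; rewrite scalerA.
Qed.

Definition quot_mod := Quotient.quot submod_span.
HB.instance Definition _ := GRing.Zmodule.on quot_mod.

Local Notation pi := (\pi_(Quotient.quot submod_span)%qT : M -> quot_mod).

Definition quot_scale (c : B) (q : quot_mod) : quot_mod := pi (c *: repr q).

Lemma quot_piP x y : reflect (pi x = pi y) (x - y \in submod_span).
Proof. by rewrite Quotient.idealrBE; exact: eqP. Qed.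

Lemma quot_reprK (q : quot_mod) : pi (repr q) = q. Proof. exact: reprK. Qed.

Lemma quot_scaleE c x : quot_scale c (pi x) = pi (c *: x).
Proof.
apply/quot_piP; rewrite -scalerBr; apply: submod_spanZ.
by apply/quot_piP; rewrite quot_reprK.
Qed.

Lemma quot_piD x y : pi (x + y) = pi x + pi y. Proof. exact: raddfD. Qed.

Fact quot_scaleA c d q : quot_scale c (quot_scale d q) = quot_scale (c * d) q.
Proof. by rewrite -[q]quot_reprK !quot_scaleE scalerA. Qed.
Fact quot_scale1 : left_id 1 quot_scale.
Proof. by move=> q; rewrite -[q]quot_reprK quot_scaleE scale1r. Qed.
Fact quot_scaleDr : right_distributive quot_scale +%R.
Proof.
move=> c p q; rewrite -[p]quot_reprK -[q]quot_reprK -quot_piD !quot_scaleE.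
by rewrite scalerDr quot_piD.
Qed.
Fact quot_scaleDl q : {morph quot_scale^~ q : c d / c + d}.
Proof.
by move=> c d; rewrite -[q]quot_reprK !quot_scaleE scalerDl quot_piD.
Qed.

HB.instance Definition _ := GRing.Zmodule_isLmodule.Build B quot_mod
  quot_scaleA quot_scale1 quot_scaleDr quot_scaleDl.

Definition quot_pi (x : M) : quot_mod := pi x.

Fact quot_pi_linear : linear quot_pi.
Proof. by move=> c x y; rewrite /quot_pi quot_piD -quot_scaleE. Qed.
HB.instance Definition _ :=
  GRing.isLinear.Build B M quot_mod *:%R quot_pi quot_pi_linear.

Lemma quot_pi_eq0 x : (quot_pi x = 0) <-> (x \in submod_span).
Proof.
rewrite -[X in quot_pi x = X](raddf0 quot_pi).
by split=> [/quot_piP|h]; [|apply/quot_piP]; rewrite subr0.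
Qed.

Definition quot_comp a : set quot_mod := [set quot_pi x | x in pm_comp a]%classic.

Fact quot_comp0 a : quot_comp a 0.
Proof. by exists 0; [exact: comp0|exact: raddf0]. Qed.

Fact quot_compD a p q : quot_comp a p -> quot_comp a q -> quot_comp a (p + q).
Proof.
move=> [x xa <-] [y ya <-]; exists (x + y); first exact: compD.
by rewrite raddfD.
Qed.

Fact quot_compZ a (c : k) q : quot_comp a q -> quot_comp a ((c%:MP : B) *: q).
Proof.
move=> [x xa <-]; exists ((c%:MP : B) *: x); first exact: compZ.
by rewrite linearZ.
Qed.

Fact quot_comp_act (i : 'I_n) (alpha : {nonneg R}) a q :
  quot_comp a q -> quot_comp (a + alpha%:num *: delta_mx 0 i)
                             (xmon (expo_axis i alpha) *: q).
Proof.
move=> [x xa <-]; exists (xmon (expo_axis i alpha) *: x); first exact: comp_act.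
by rewrite linearZ.
Qed.

Fact quot_span q : exists (s : seq vec) (u : vec -> quot_mod),
  [/\ uniq s, forall a, quot_comp a (u a) & q = \sum_(a <- s) u a].
Proof.
have [s [u [us uc e]]] := comp_span (repr q).
exists s, (fun a => quot_pi (u a)); split=> // [a|]; first by exists (u a).
by rewrite -raddf_sum -e [RHS]quot_reprK.
Qed.

Hypothesis homS : forall r, r \in S -> homogeneous r.

Let span_dec (x : M) := exists (s : seq vec) (u : vec -> M),
  [/\ uniq s, forall a, pm_comp a (u a), forall a, u a \in submod_span
    & x = \sum_(a <- s) u a].

Let extend (s t : seq vec) (u : vec -> M) : uniq s -> uniq t ->
  {subset s <= t} ->
  \sum_(a <- s) u a = \sum_(a <- t) (if a \in s then u a else 0).
Proof.
move=> us ut st; rewrite -big_mkcond -big_filter; apply: perm_big.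
apply: uniq_perm; rewrite ?filter_uniq // => a; rewrite mem_filter.
by case: (boolP (a \in s)) => [/st ->|].
Qed.

Let span_decD x y : span_dec x -> span_dec y -> span_dec (x + y).
Proof.
move=> [s [u [us uc uS ->]]] [t [v [vs vc vS ->]]].
exists (undup (s ++ t)), (fun a =>
  (if a \in s then u a else 0) + (if a \in t then v a else 0)).
split; first exact: undup_uniq.
- by move=> a; apply: compD; case: ifP => _ //; exact: comp0.
- by move=> a; rewrite rpredD //; case: ifP => _ //; rewrite rpred0.
rewrite (@extend s (undup (s ++ t))) ?undup_uniq //; last first.
  by move=> a sa; rewrite mem_undup mem_cat sa.
rewrite (@extend t (undup (s ++ t))) ?undup_uniq // ?big_split //.
by move=> a ta; rewrite mem_undup mem_cat ta orbT.
Qed.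

Let span_dec1 a x : pm_comp a x -> x \in submod_span -> span_dec x.
Proof.
move=> xa xS; exists [:: a], (fun b => if b == a then x else 0).
split=> // [b|b|]; last by rewrite big_seq1 eqxx.
  by case: eqP => [->|_] //; exact: comp0.
by case: eqP => // _; rewrite rpred0.
Qed.

Let span_dec_sum (I : Type) (r : seq I) (F : I -> M) :
  (forall i, span_dec (F i)) -> span_dec (\sum_(i <- r) F i).
Proof.
move=> hF; apply: big_ind => //.
by apply: (@span_dec1 0); [exact: comp0|exact: rpred0].
Qed.

Let span_decP x : x \in submod_span -> span_dec x.
Proof.
case/submod_spanP => c ->; rewrite big_seq_cond.
apply: big_ind => [||r]; [|exact: span_decD|].
  by apply: (@span_dec1 0); [exact: comp0|exact: rpred0].
rewrite andbT => rS; have [a ra] := homS rS.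
have rspan : r \in submod_span.
  apply/submod_spanP; exists (fun x => (x == r)%:R).
  rewrite (big_fsetD1 r) //= eqxx scale1r big1_seq ?addr0 // => z /=.
  by rewrite in_fsetD1 => /andP[/negbTE-> _]; rewrite scale0r.
rewrite [c r]monalgE scaler_suml; apply: span_dec_sum => e.
apply: (@span_dec1 (a + e)); last exact: submod_spanZ.
have -> : (<< (c r)@_e *g e >> : B) = ((c r)@_e)%:MP * xmon e.
  by rewrite [RHS]fgmulUU mulr1 mul1m.
by rewrite -scalerA; apply: compZ; exact: comp_mon.
Qed.

Fact quot_indep (s : seq vec) (u : vec -> quot_mod) : uniq s ->
  (forall a, quot_comp a (u a)) -> \sum_(a <- s) u a = 0 ->
  forall a, a \in s -> u a = 0.
Proof.
move=> us uc su a sa.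
have {}uc b : exists x, pm_comp b x /\ quot_pi x = u b.
  by have [x] := uc b; exists x.
pose w b := xget 0 [set x | pm_comp b x /\ quot_pi x = u b]%classic.
have wP b : pm_comp b (w b) /\ quot_pi (w b) = u b.
  by rewrite /w; case: xgetP => // /(_ _)/=; have [x xP] := uc b; move=> /(_ x).
have : \sum_(b <- s) w b \in submod_span.
  apply/quot_pi_eq0; rewrite raddf_sum -[RHS]su.
  by apply: eq_bigr => b _; case: (wP b).
case/span_decP => t [v [vt vc vS /eqP]]; rewrite -subr_eq0.
pose z := undup (s ++ t).
rewrite (@extend s z) ?undup_uniq //; last first.
  by move=> b sb; rewrite mem_undup mem_cat sb.
rewrite (@extend t z) ?undup_uniq //; last first.
  by move=> b tb; rewrite mem_undup mem_cat tb orbT.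
rewrite -sumrB => /eqP d0.
have dc b : pm_comp b
    ((if b \in s then w b else 0) - (if b \in t then v b else 0)).
  apply: compD; first by case: ifP => _; [case: (wP b)|exact: comp0].
  by apply: compN; case: ifP => _ //; exact: comp0.
have az : a \in z by rewrite mem_undup mem_cat sa.
have := comp_indep (undup_uniq _) dc d0 az.
rewrite sa => /eqP; rewrite subr_eq0 => /eqP wa.
rewrite -(wP a).2; apply/quot_pi_eq0; rewrite wa.
by case: ifP => _ //; exact: rpred0.
Qed.

Definition quot_pm : pmod :=
  @PersMod k R n quot_mod quot_comp quot_comp0 quot_compD
    quot_compZ quot_span quot_indep quot_comp_act.

End Quotient.

Definition finitely_presented M : Prop :=
  exists (G : finType) (gr : G -> vec) (S : {fset free_pm gr})
    (homS : forall r, r \in S -> homogeneous r),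
    isomorphic M (quot_pm homS).

End PersistenceModules.

(* Main.v *)
Require Import Defs.
From HB Require Import structures.
From mathcomp Require Import all_boot all_order all_algebra.
From mathcomp Require Import finmap monalg lra.
From mathcomp Require Import boolp classical_sets interval_inference reals ereal.

Set Implicit Arguments.
Unset Strict Implicit.
Unset Printing Implicit Defensive.

Import Order.TTheory GRing.Theory Num.Theory.
Local Open Scope ring_scope.

(* Multiplication by x^t is an isomorphism from N_w to N_(w + t) as soon as no grade
   of a generator or relator is <= w + t without being <= w, which holds for all
   small t >= 0. Take f' : M -> N(delta) and g' : N -> M(delta) from an interleaving
   with delta = eps + t and t small. Dividing by x^t the values of f' on generators,
   by surjectivity at the relevant grades of N, gives f : M -> N(eps) with
   x^t f = f': the relators are killed because x^t is injective at their shifted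
   grades. Likewise x^t g = g'. Then x^(2t) (g f - x^(2 eps)) = 0, and g f = x^(2 eps)
   on generators by injectivity of x^(2t). *)

(** * Homogeneous sums and their division by a monomial *)

Lemma vec_leP (R : realType) n (a b : 'rV[R]_n) :
  reflect (forall i, a 0 i <= b 0 i) (vec_le a b).
Proof. exact: forallP. Qed.

Lemma malgU_xmon (k : fieldType) (R : realType) n (c : k) (e : expo R n) :
  (<< c *g e >> : Bn k R n) = (c%:MP : Bn k R n) * xmon e.
Proof. by rewrite [RHS]fgmulUU mulr1 mul1m. Qed.

(** Sorting the sum by degree and subtracting [x] in degree [a] leaves a vanishing sum of
    homogeneous elements of distinct degrees, so [comp_indep] kills each of them. *)
Lemma homogeneous_part_sum (k : fieldType) (R : realType) n (M : persMod k R n)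
    (I : eqType) (s : seq I) (d : I -> 'rV[R]_n) (u : I -> M) a (x : M) :
  {in s, forall i, pm_comp (d i) (u i)} -> pm_comp a x ->
  x = \sum_(i <- s) u i -> x = \sum_(i <- s | d i == a) u i.
Proof.
move=> uc xa xE.
pose t := undup (a :: map d s).
pose v b := \sum_(i <- s | d i == b) u i - (if b == a then x else 0).
have vc b : pm_comp b (v b).
  apply: compD.
    by rewrite big_seq_cond; apply: comp_sum => i /andP[/uc ? /eqP <-].
  by apply: compN; case: eqP => [->//|_]; exact: comp0.
have ta : a \in t by rewrite mem_undup mem_head.
have one_term b (y : M) : b \in t -> \sum_(b' <- t) (if b' == b then y else 0) = y.
  move=> bt; rewrite (bigD1_seq b) ?undup_uniq //= eqxx big1 ?addr0 //.
  by move=> b' /negbTE ->.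
have v0 : \sum_(b <- t) v b = 0.
  rewrite sumrB one_term //.
  under eq_bigr do rewrite big_mkcond.
  rewrite exchange_big xE -sumrB big_seq big1 // => i si.
  under eq_bigr do rewrite [d i == _]eq_sym.
  by rewrite one_term ?subrr // mem_undup in_cons map_f ?orbT.
have := comp_indep (undup_uniq _) vc v0 ta.
by rewrite /v eqxx => /eqP; rewrite subr_eq0 => /eqP.
Qed.

(* Only the monomials [x^f] of the coefficients with [d i + f = w + e] contribute
   to [x]; such an [i] has [d i <= w], so [x^f] is [x^e] times [x^(w - d i)]. *)
Lemma span_divide (k : fieldType) (R : realType) n (M : persMod k R n)
    (I : eqType) (s : seq I) (d : I -> 'rV[R]_n) (r : I -> M) (c : I -> Bn k R n)
    (w : 'rV[R]_n) (e : expo R n) :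
  {in s, forall i, pm_comp (d i) (r i)} ->
  {in s, forall i, vec_le (d i) (w + e) -> vec_le (d i) w} ->
  pm_comp (w + e) (\sum_(i <- s) c i *: r i) ->
  exists c' : I -> Bn k R n, pm_comp w (\sum_(i <- s) c' i *: r i) /\
    \sum_(i <- s) c i *: r i = xmon e *: \sum_(i <- s) c' i *: r i.
Proof.
move=> rc dw xc.
(* The default [0] keeps [q i *: r i] in degree [w] for every [i] in [s]; it never occurs in a term
   with [d i + f = w + e]. *)
pose q (i : I) : Bn k R n :=
  if insub (w - d i) is Some g then xmon g else 0.
exists (fun i =>
  \sum_(f <- msupp (c i) | d i + val f == w + e) ((c i)@_f)%:MP * q i).
have qc i : i \in s -> pm_comp w (q i *: r i).
  move=> si; rewrite /q; case: insubP => [g _ gE|_]; last first.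
    by rewrite scale0r; exact: comp0.
  by have := comp_mon g (rc i si); rewrite [expo_val g]gE addrC subrK.
split.
  rewrite big_seq; apply: comp_sum => i si; rewrite scaler_suml.
  by apply: comp_sum => f _; rewrite -scalerA; apply: compZ; exact: qc.
(* Indexing by pairs of an index and a monomial of its coefficient makes every term homogeneous. *)
pose S := [seq (i, f) | i <- s, f <- msupp (c i)].
have e1 : \sum_(i <- s) c i *: r i =
          \sum_(j <- S) (((c j.1)@_(j.2))%:MP * xmon j.2 : Bn k R n) *: r j.1.
  rewrite big_allpairs_dep /=; apply: eq_bigr => i _.
  rewrite {1}[c i]monalgE scaler_suml; apply: eq_bigr => f _.
  by rewrite malgU_xmon.
rewrite (@homogeneous_part_sum _ _ _ M _ S (fun j => d j.1 + val j.2) _ _ _ _ xc e1);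
    last first.
  move=> _ /allpairsPdep[i [f [si sf ->]]] /=; rewrite -scalerA.
  by apply: compZ; apply: comp_mon; exact: rc.
rewrite big_mkcond big_allpairs_dep scaler_sumr /= big_seq [RHS]big_seq.
apply: eq_bigr => i si; rewrite -big_mkcond /= scaler_suml scaler_sumr.
apply: eq_bigr => f /eqP fE.
have dle : vec_le (d i) w.
  by apply: dw => //; apply/vec_leP => l; rewrite -fE !mxE lerDl expoP.
have -> : xmon f = xmon e * q i.
  rewrite /q insubT => [|g]; first exact: expo_sub_subproof dle.
  rewrite -xmonD; congr xmon; apply/val_inj => /=.
  by rewrite addrA [_ + w]addrC -fE addrAC subrr add0r.
move: (_%:MP : Bn k R n) => a.
by rewrite scalerA mulrCA.
Qed.

(** * Graded free modules *)

Lemma free_torsion_free (k : fieldType) (R : realType) n (G : finType)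
    (gr : G -> 'rV[R]_n) (e : expo R n) (p : free_pm k gr) :
  xmon e *: p = 0 -> p = 0.
Proof.
have expo_addI f g : (expo_add e f == expo_add e g) = (f == g).
  apply/eqP/eqP => [|->//] /(congr1 val) /addrI fg; exact: val_inj.
move=> p0; apply/ffunP => y; rewrite [RHS]ffunE; apply/malgP => f.
(* Translation by [e] is injective on exponents, so this coefficient equals that of [x^f] in
   [p y]. *)
have : (xmon e * (p : {ffun G -> Bn k R n}) y)@_(expo_add e f) = 0.
  have /ffunP/(_ y) := p0; rewrite !ffunE => py.
  by have := congr1 (mcoeff (expo_add e f)) py; rewrite mcoeff0.
rewrite malgM_def fgmulUg raddf_sum /=.
under eq_bigr do rewrite mcoeffU mul1r expo_addI.
have [fp|fp] := boolP (f \in msupp (p y : Bn k R n)); last first.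
  by move=> _; rewrite mcoeff0; exact: mcoeff_outdom.
rewrite (bigD1_seq f) ?fset_uniq //= eqxx mulr1n big1 ?addr0 ?mcoeff0 //.
by move=> g /negbTE ->.
Qed.

Definition free_gen (k : fieldType) (R : realType) n (G : finType)
    (gr : G -> 'rV[R]_n) (y : G) : free_pm k gr := [ffun z => (z == y)%:R].

Lemma free_gen_comp (k : fieldType) (R : realType) n (G : finType)
    (gr : G -> 'rV[R]_n) (y : G) : pm_comp (gr y) (free_gen k gr y).
Proof.
move=> z; rewrite ffunE; case: eqP => [-> | _]; last exact: comp0.
move=> e; rewrite subrr.
by move=> /(fsubsetP msuppU_le); rewrite inE => /eqP ->.
Qed.

Lemma free_genE (k : fieldType) (R : realType) n (G : finType)
    (gr : G -> 'rV[R]_n) (p : free_pm k gr) :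
  p = \sum_y (p : {ffun G -> Bn k R n}) y *: free_gen k gr y.
Proof.
apply/ffunP => z; rewrite sum_ffunE (bigD1 z) //= big1 => [|y yz].
  by rewrite !ffunE eqxx addr0 [RHS]mulr1.
by rewrite !ffunE eq_sym (negbTE yz) scaler0.
Qed.

Lemma free_gen_eq (k : fieldType) (R : realType) n (G : finType)
    (gr : G -> 'rV[R]_n) (N : persMod k R n) (f g : {linear free_pm k gr -> N}) :
  (forall y, f (free_gen k gr y) = g (free_gen k gr y)) -> f =1 g.
Proof.
move=> fg p; rewrite [p]free_genE !linear_sum.
by apply: eq_bigr => y _; rewrite !linearZ_LR fg.
Qed.

(** Universal property of the free module. Degrees are kept because in an element of degree [a] the
    coefficient at [y] has only the exponent [a - gr y]. *)
Lemma free_lift (k : fieldType) (R : realType) n (G : finType)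
    (gr : G -> 'rV[R]_n) (N : persMod k R n) (v : G -> N) :
  (forall y, pm_comp (gr y) (v y)) ->
  exists F : Defs.hom (free_pm k gr) N, forall y, F (free_gen k gr y) = v y.
Proof.
move=> vc.
pose F (p : free_pm k gr) : N :=
  \sum_y (p : {ffun _ -> Bn k R n}) y *: v y.
have F_lin : linear F.
  move=> c p q; rewrite /F scaler_sumr -big_split; apply: eq_bigr => y _ /=.
  by rewrite !ffunE scalerDl scalerA.
pose lF : {linear free_pm k gr -> N} :=
  HB.pack F (GRing.isLinear.Build _ _ _ _ F F_lin).
have F_comp a p : pm_comp a p -> pm_comp a (lF p).
  move=> pa; apply: comp_sum => y _.
  rewrite {1}[(p : {ffun _ -> Bn k R n}) y]monalgE scaler_suml big_seq.
  apply: comp_sum => e /(pa y) eE; rewrite malgU_xmon -scalerA; apply: compZ.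
  by have := comp_mon e (vc y); rewrite [expo_val e]eE addrC subrK.
exists (Defs.Hom F_comp) => y.
rewrite /= /F (bigD1 y) //= ffunE eqxx scale1r big1 ?addr0 // => z zy.
by rewrite ffunE (negbTE zy) scale0r.
Qed.

(** * Presentations as covers by free modules *)

Record presentation (k : fieldType) (R : realType) n (M : persMod k R n) :=
  Presentation {
    gens : finType;
    gen_deg : gens -> 'rV[R]_n;
    rels : {fset free_pm k gen_deg};
    rel_deg : free_pm k gen_deg -> 'rV[R]_n;
    rel_degP : {in rels, forall r, pm_comp (rel_deg r) r};
    cover : Defs.hom (free_pm k gen_deg) M;
    cover_surj : forall x, exists p, cover p = x;
    cover_comp_surj : forall a x, pm_comp a x ->
      exists2 p, pm_comp a p & cover p = x;
    cover_ker : forall p, cover p = 0 <-> p \in submod_span rels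
  }.

Arguments gen_deg {k R n M} P y : rename.

Definition gen (k : fieldType) (R : realType) n (M : persMod k R n)
  (P : presentation M) (y : gens P) : M := cover P (free_gen k (gen_deg P) y).

(** The cover is the quotient map followed by the isomorphism onto [M]. Homogeneous lifts exist
    because the components of a quotient are images of components. *)
Lemma finitely_presentedP (k : fieldType) (R : realType) n (M : persMod k R n) :
  finitely_presented M -> inhabited (presentation M).
Proof.
move=> [G [gr [S [homS [f [g [fK gK]]]]]]].
(* The default degree [0] is never reached on [S], whose elements are homogeneous. *)
pose d r := xget 0 [set a | pm_comp (M := free_pm k gr) a r]%classic.
have dP : {in S, forall r, pm_comp (d r) r}.
  by move=> r /homS[a ra]; rewrite /d; case: xgetP => [b -> //|/(_ a)].
pose q : {linear free_pm k gr -> quot_pm homS} := @quot_pi _ _ _ _ S.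
have qc a p : pm_comp a p -> pm_comp a (q p) by exists p.
pose p := hom_compose g (Defs.Hom qc).
have p_surj x : exists u, p u = x.
  by exists (repr (f x)); rewrite /= [X in g X]quot_reprK fK.
have p_comp_surj a x : pm_comp a x -> exists2 u, pm_comp a u & p u = x.
  by move=> /(hom_comp f) [u ua uE]; exists u => //=; rewrite [X in g X]uE fK.
have p_ker u : p u = 0 <-> u \in submod_span S.
  rewrite -quot_pi_eq0 /=; split=> [gu|->]; last exact: raddf0.
  by have := congr1 f gu; rewrite gK raddf0.
by exists; exact: (Presentation dP p_surj p_comp_surj p_ker).
Qed.

Section PresentedModule.
Context (k : fieldType) (R : realType) (n : nat) (M : persMod k R n).
Context (P : presentation M).

Lemma gen_comp y : pm_comp (gen_deg P y) (gen y).
Proof. by apply: hom_comp; exact: free_gen_comp. Qed.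

Lemma gen_span x : exists c : gens P -> Bn k R n, x = \sum_y c y *: gen y.
Proof.
have [p <-] := cover_surj P x; exists (fun y => (p : {ffun _ -> _}) y).
rewrite {1}[p]free_genE raddf_sum.
by apply: eq_bigr => y _; exact: linearZZ.
Qed.

(** [F] vanishes on the kernel of the cover, so its value at a preimage does not depend on the
    choice. *)
Lemma presentation_lift (N : persMod k R n) (F : Defs.hom (free_pm k (gen_deg P)) N) :
  {in rels P, forall r, F r = 0} ->
  exists f : Defs.hom M N, forall p, f (cover P p) = F p.
Proof.
move=> F_rel.
have F_ker p : cover P p = 0 -> F p = 0.
  move=> /cover_ker /submod_spanP[c ->]; rewrite raddf_sum big_seq big1 // => r rS.
  by rewrite [LHS]linearZ_LR /= F_rel // scaler0.
have F_eq p q : cover P p = cover P q -> F p = F q.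
  move=> pq; apply/eqP; rewrite -subr_eq0 -raddfB.
  apply/eqP/F_ker; rewrite raddfB; apply/eqP; rewrite subr_eq0; exact/eqP.
pose lift x := xget 0 [set p | cover P p = x]%classic.
have liftK x : cover P (lift x) = x.
  by have [p px] := cover_surj P x; rewrite /lift; case: xgetP => // /(_ p).
pose f x := F (lift x).
have fE p : f (cover P p) = F p by apply: F_eq; rewrite liftK.
have f_lin : linear f.
  by move=> c x y; rewrite -[x]liftK -[y]liftK -linearZ -raddfD !fE linearP.
pose lf : {linear M -> N} := HB.pack f (GRing.isLinear.Build _ _ _ _ f f_lin).
(* The section [lift] may break degrees, so a homogeneous preimage replaces it. *)
have f_comp a x : pm_comp a x -> pm_comp a (lf x).
  by move=> /(cover_comp_surj P) [p pa <-] /=; rewrite fE; exact: hom_comp.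
by exists (Defs.Hom f_comp).
Qed.

Lemma gen_eq (N : persMod k R n) (f g : {linear M -> N}) :
  (forall y : gens P, f (gen y) = g (gen y)) -> f =1 g.
Proof.
move=> fg x; have [p <-] := cover_surj P x.
exact: (free_gen_eq (f := comp_lin f (cover P)) (g := comp_lin g (cover P)) fg).
Qed.

(** * Degrees at which a monomial acts bijectively *)

Definition same_below (a b : 'rV[R]_n) : Prop :=
  (forall y, vec_le (gen_deg P y) b -> vec_le (gen_deg P y) a) /\
  {in rels P, forall r, vec_le (rel_deg r) b -> vec_le (rel_deg r) a}.

Lemma same_below_surj w e x : same_below w (w + expo_val e) ->
  pm_comp (w + e) x -> exists2 z : M, pm_comp w z & xmon e *: z = x.
Proof.
move=> [gen_below _]; have [c ->] := gen_span x => xc.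
have gen_c : {in index_enum (gens P), forall y, pm_comp (gen_deg P y) (gen y)}.
  by move=> y _; exact: gen_comp.
have gen_b : {in index_enum (gens P), forall y,
    vec_le (gen_deg P y) (w + e) -> vec_le (gen_deg P y) w}.
  by move=> y _; exact: gen_below.
have [c' [zw ->]] := span_divide gen_c gen_b xc.
by exists (\sum_y c' y *: gen y).
Qed.

(** Let [p] be a homogeneous lift of [x]. If [x^e p] is a combination of relators, division gives a
    combination [q] of relators with [x^e p = x^e q], and [p = q] since the free module is torsion
    free. *)
Lemma same_below_inj w e (x : M) : same_below w (w + expo_val e) ->
  pm_comp w x -> xmon e *: x = 0 -> x = 0.
Proof.
move=> [_ rel_below] /(cover_comp_surj P) [p pw <-].
rewrite -[X in X = 0 -> _](linearZ_LR (cover P)) => /cover_ker/submod_spanP[c pE].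
have := comp_mon e pw; rewrite pE => pc.
have [c' [_ c'E]] := span_divide (@rel_degP _ _ _ _ P) rel_below pc.
apply/cover_ker/submod_spanP; exists c'; move: (etrans pE c'E).
move: (\sum_(r <- rels P) c' r *: r) => q pq.
apply/eqP; rewrite -subr_eq0; apply/eqP/(@free_torsion_free _ _ _ _ _ e).
by rewrite scalerBr pq subrr.
Qed.

End PresentedModule.

(** Detached from any presentation, since it is also applied in one module at degrees read off a
    presentation of the other. *)
Definition mon_bij (k : fieldType) (R : realType) n (M : persMod k R n)
    (w : 'rV[R]_n) (e : expo R n) : Prop :=
  (forall x, pm_comp (w + e) x -> exists2 z : M, pm_comp w z & xmon e *: z = x) /\
  (forall x : M, pm_comp w x -> xmon e *: x = 0 -> x = 0).

(** A failure of [c <= w] is witnessed by a coordinate with [w_i < c_i] and persists for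
    [t < c_i - w_i]; finitely many pairs admit a common bound. *)
Lemma no_jump_near (R : realType) n (s : seq ('rV[R]_n * 'rV[R]_n)) :
  exists2 theta : R, 0 < theta & forall t, t < theta ->
    {in s, forall cw, vec_le cw.1 (cw.2 + const_mx t) -> vec_le cw.1 cw.2}.
Proof.
elim: s => [|[c w] s [theta theta0 IHs]]; first by exists 1.
have [cw|/vec_leP/existsNP[i /negP]] := boolP (vec_le c w).
  by exists theta => // t t_lt u; rewrite in_cons => /predU1P[->//|]; exact: IHs.
rewrite -ltNge => wc; exists (Num.min theta (c 0 i - w 0 i)).
  by rewrite lt_min theta0 subr_gt0.
move=> t; rewrite lt_min => /andP[/IHs sP ti] u; rewrite in_cons.
case/predU1P => [-> /vec_leP/(_ i)|]; last exact: sP.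
by rewrite /= !mxE addrC -lerBlDr leNgt ti.
Qed.

Lemma mon_bij_near (k : fieldType) (R : realType) n (M : persMod k R n)
    (P : presentation M) (Z : seq 'rV[R]_n) :
  exists2 theta : R, 0 < theta & forall t : {nonneg R}, t%:num < theta ->
    {in Z, forall w, mon_bij M w (expo_const n t)}.
Proof.
have [theta theta0 thetaP] := no_jump_near
  [seq (c, w) | c <- map (gen_deg P) (enum (gens P)) ++
                     map (@rel_deg _ _ _ _ P) (rels P), w <- Z].
exists theta => // t /thetaP tP w wZ.
suff below : same_below P w (w + expo_const n t).
  by split=> x; [exact: same_below_surj below|exact: same_below_inj below].
split=> [y|r rS]; apply: (tP (_, _)); apply: allpairs_f => //; rewrite mem_cat.
- by rewrite map_f ?mem_enum.
- by rewrite (map_f _ rS) orbT.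
Qed.

(** * Division of interleaving morphisms *)

Lemma hom_divide (k : fieldType) (R : realType) n (M N : persMod k R n)
    (P : presentation M) (eps delta t : {nonneg R}) (f' : Defs.hom M (shiftc delta N)) :
  delta%:num = eps%:num + t%:num ->
  (forall y, mon_bij N (gen_deg P y + const_mx eps%:num) (expo_const n t)) ->
  {in rels P, forall r, mon_bij N (rel_deg r + const_mx eps%:num) (expo_const n t)} ->
  exists f : Defs.hom M (shiftc eps N),
    forall x : M, xmon (expo_const n t) *: (f x : N) = f' x.
Proof.
move=> deltaE gen_bij rel_bij.
have shiftE (a : 'rV[R]_n) :
    a + const_mx delta%:num = a + const_mx eps%:num + const_mx t%:num.
  by rewrite -addrA; congr (_ + _); apply/rowP => i; rewrite !mxE deltaE.
have vP y : exists z : N, pm_comp (gen_deg P y + const_mx eps%:num) z /\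
    xmon (expo_const n t) *: z = f' (gen y).
  have := hom_comp f' (gen_comp y).
  by rewrite /= shiftE => /(proj1 (gen_bij y)) [z zc zE]; exists z.
have [v {}vP] := choice vP.
have [F FE] := @free_lift _ _ _ _ _ (shiftc eps N) v (fun y => proj1 (vP y)).
pose mon_t : {linear N -> N} := @mul_mon _ _ _ N (expo_const n t).
have FP p : xmon (expo_const n t) *: (F p : N) = f' (cover P p).
  apply: (free_gen_eq (f := comp_lin mon_t (F : {linear _ -> N}))
                      (g := comp_lin (f' : {linear M -> N}) (cover P))) => y.
  by rewrite /= FE; exact: (proj2 (vP y)).
(* In [N] the element [F r] has degree [rel_deg r + eps], which is where [rel_bij] provides
   injectivity. *)
have F_rel : {in rels P, forall r, F r = 0}.
  move=> r rS; apply: (proj2 (rel_bij r rS)).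
    by apply: (hom_comp F); exact: rel_degP.
  rewrite FP; suff -> : cover P r = 0 by exact: raddf0.
  apply/cover_ker/submod_spanP; exists (fun z => (z == r)%:R).
  rewrite (big_fsetD1 r) //= eqxx scale1r big1_seq ?addr0 // => z /=.
  by rewrite in_fsetD1 => /andP[/negbTE-> _]; rewrite scale0r.
have [f fE] := presentation_lift F_rel.
by exists f => x; have [p <-] := cover_surj P x; rewrite fE FP.
Qed.

Lemma xmon_constD (k : fieldType) (R : realType) n (a b c : {nonneg R}) :
  a%:num = b%:num + c%:num ->
  xmon (expo_const n a) = xmon (expo_const n b) * xmon (expo_const n c) :> Bn k R n.
Proof.
move=> abc; rewrite -xmonD; congr xmon; apply/val_inj/rowP => i.
by rewrite !mxE abc.
Qed.

(** One of the two interleaving identities; exchanging [M] and [N] gives the other. Doubled numbers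
    are variables tied by equations, so that both [2 * eps] and a number built as a sum fit. *)
Lemma compose_divide (k : fieldType) (R : realType) n (M N : persMod k R n)
    (P : presentation M) (eps eps2 delta delta2 t t2 : {nonneg R})
    (f : Defs.hom M (shiftc eps N)) (g : Defs.hom N (shiftc eps M))
    (f' : Defs.hom M (shiftc delta N)) (g' : Defs.hom N (shiftc delta M)) :
  eps2%:num = eps%:num + eps%:num -> t2%:num = t%:num + t%:num ->
  delta2%:num = t2%:num + eps2%:num ->
  (forall x : M, xmon (expo_const n t) *: (f x : N) = f' x) ->
  (forall y : N, xmon (expo_const n t) *: (g y : M) = g' y) ->
  (forall x : M, g' (f' x) = shift_map M delta2 x) ->
  (forall y, mon_bij M (gen_deg P y + const_mx eps2%:num) (expo_const n t2)) ->
  forall x : M, g (f x) = shift_map M eps2 x.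
Proof.
move=> eps2E t2E delta2E fE gE gf' gen_bij.
pose gf : {linear M -> M} := comp_lin (g : {linear N -> M}) (f : {linear M -> N}).
pose S2 : {linear M -> M} := @mul_mon _ _ _ M (expo_const n eps2).
suff : gf =1 S2 by [].
apply: (gen_eq (P := P)) => y; apply/eqP; rewrite -subr_eq0; apply/eqP.
have const2 : const_mx eps2%:num = const_mx eps%:num + const_mx eps%:num :> 'rV[R]_n.
  by apply/rowP => i; rewrite !mxE eps2E.
(* Both composites send a generator into the component of degree [gen_deg P y + eps2], where [x^t2]
   is injective. *)
apply: (proj2 (gen_bij y)).
  apply: compD; last first.
    by apply: compN; exact: (@comp_mon _ _ _ M _ (expo_const n eps2) _ (gen_comp y)).
  by rewrite const2 addrA; apply: (hom_comp g); apply: (hom_comp f); exact: gen_comp.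
(* One factor [x^t] turns [g] into [g']; the other passes through [g] by linearity and turns [f]
   into [f']. *)
have gfE : xmon (expo_const n t2) *: (g (f (gen y)) : M) = g' (f' (gen y)).
  rewrite (xmon_constD _ _ t2E) -scalerA -gE -fE; congr (_ *: _).
  by apply/esym; exact: linearZZ.
apply/eqP; rewrite scalerBr subr_eq0; apply/eqP/(etrans gfE); rewrite gf'.
by rewrite /= /mul_mon (xmon_constD _ _ delta2E) scalerA.
Qed.

Theorem theorem2p5p1 (k : fieldType) (R : realType) (n : nat) (n_ge1 : (1 <= n)%N)
  (M N : persMod k R n)
  (hM : finitely_presented M) (hN : finitely_presented N)
  (eps : {nonneg R}) (heps : interleaving_distance M N = (eps%:num)%:E) :
  interleaved M N eps.
Proof.
have [P] := finitely_presentedP hM; have [Q] := finitely_presentedP hN.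
pose degs (L : persMod k R n) (T : presentation L) : seq 'rV[R]_n :=
  map (gen_deg T) (enum (gens T)) ++ map (@rel_deg _ _ _ _ T) (rels T).
(* The shift by [eps] serves the division of [f'] and [g'], the shift by [2 * eps] the comparison of
   the composites. *)
pose Z := [seq a + const_mx eps%:num | a <- degs M P ++ degs N Q]
  ++ [seq a + const_mx (2 * eps%:num) | a <- degs M P ++ degs N Q].
have [thM thM_gt0 bijM] := mon_bij_near P Z.
have [thN thN_gt0 bijN] := mon_bij_near Q Z.
(* Halved because not only [t] but also its double [s] must stay below the thresholds. *)
have theta_gt0 : 0 < Num.min thM thN / 2 by rewrite divr_gt0 // lt_min thM_gt0.
(* Some interleaving parameter lies below any number exceeding the infimum [eps], and none lies
   below [eps]; [delta = eps] is allowed. *)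
have [delta [f' [g' [gf' fg']]] [delta_ge delta_lt]] :
    exists2 delta : {nonneg R}, interleaved M N delta &
      eps%:num <= delta%:num /\ delta%:num < eps%:num + Num.min thM thN / 2.
  have : (interleaving_distance M N < (eps%:num + Num.min thM thN / 2)%:E)%E.
    by rewrite heps lte_fin ltrDl.
  move=> /ereal_inf_lt[_ [delta MN <-]]; rewrite lte_fin => delta_lt.
  exists delta => //; split=> //; rewrite -lee_fin -heps.
  by apply: ereal_inf_lbound; exists delta.
have t_ge0 : 0 <= delta%:num - eps%:num by rewrite subr_ge0.
pose t : {nonneg R} := NngNum t_ge0.
have s_ge0 : 0 <= t%:num + t%:num by rewrite addr_ge0.
pose s : {nonneg R} := NngNum s_ge0.
have deltaE : delta%:num = eps%:num + t%:num by rewrite /= addrC subrK.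
have [t_lt s_lt] : t%:num < Num.min thM thN /\ s%:num < Num.min thM thN.
  by rewrite /=; lra.
have [tM tN] : t%:num < thM /\ t%:num < thN by apply/andP; rewrite -lt_min.
have [sM sN] : s%:num < thM /\ s%:num < thN by apply/andP; rewrite -lt_min.
have memP y : gen_deg P y \in degs M P ++ degs N Q.
  by rewrite !mem_cat map_f ?mem_enum.
have memQ y : gen_deg Q y \in degs M P ++ degs N Q.
  by rewrite !mem_cat map_f ?mem_enum ?orbT.
have relP r : r \in rels P -> rel_deg r \in degs M P ++ degs N Q.
  by move=> rP; rewrite !mem_cat (map_f _ rP) ?orbT.
have relQ r : r \in rels Q -> rel_deg r \in degs M P ++ degs N Q.
  by move=> rQ; rewrite !mem_cat (map_f _ rQ) ?orbT.
have inZ1 a : a \in degs M P ++ degs N Q -> a + const_mx eps%:num \in Z.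
  by move=> aD; rewrite mem_cat (map_f (fun a => a + const_mx eps%:num)).
have inZ2 a : a \in degs M P ++ degs N Q -> a + const_mx (2 * eps%:num) \in Z.
  by move=> aD; rewrite mem_cat (map_f (fun a => a + const_mx (2 * eps%:num))) ?orbT.
(* [f'] is divided in [N] at the degrees of [P], and [g'] in [M] at the degrees of [Q]. *)
have [f fE] := hom_divide f' deltaE (fun y => bijN t tN _ (inZ1 _ (memP y)))
  (fun r rP => bijN t tN _ (inZ1 _ (relP r rP))).
have [g gE] := hom_divide g' deltaE (fun y => bijM t tM _ (inZ1 _ (memQ y)))
  (fun r rQ => bijM t tM _ (inZ1 _ (relQ r rQ))).
exists f, g; split.
  apply: (@compose_divide k R n M N P eps (2 * eps%:num)%:nng delta
    (2 * delta%:num)%:nng t s f g f' g') => //= [||y]; [lra|lra|].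
  exact: bijM s sM _ (inZ2 _ (memP y)).
apply: (@compose_divide k R n N M Q eps (2 * eps%:num)%:nng delta
  (2 * delta%:num)%:nng t s g f g' f') => //= [||y]; [lra|lra|].
exact: bijN s sN _ (inZ2 _ (memQ y)).
Qed.
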